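(* Let $T \in \mathbf{B}(\mathcal H)$ be hyponormal (i.e. $T^*T - TT^* \geq 0$). Then $T$ is not subspace-hypercyclic for any nonzero subspace of $\mathcal H$.
   Context: $\mathcal H$ is a separable Hilbert space over $\mathbb C$; $\mathbf{B}(\mathcal H)$ is the set of bounded linear operators on $\mathcal H$; ''subspace'' always means topologically closed linear subspace; $\mathbb N_0 = \mathbb N\cup\{0\}$. For $x\in\mathcal H$, $\operatorname{Orb}(T,x) := \{T^n x : n\in\mathbb N_0\}$. $T$ is subspace-hypercyclic for a nonzero subspace $\mathcal M$ if there exists $x\in\mathcal H$ such that $\operatorname{Orb}(T,x)\cap\mathcal M$ is dense in $\mathcal M$. *)

(* Defs.v *)
From HB Require Import structures.
From mathcomp Require Import all_boot all_order all_algebra.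
From mathcomp Require Import all_classical all_reals all_analysis.
From mathcomp Require Import complex.

Set Implicit Arguments.
Unset Strict Implicit.
Unset Printing Implicit Defensive.

Import Order.TTheory GRing.Theory Num.Theory.
Import numFieldNormedType.Exports.

Local Open Scope classical_set_scope.
Local Open Scope ring_scope.

(* Complex Hilbert spaces: complete normed spaces over R[i] whose norm comes
   from an inner product, linear in its first argument and conjugate-linear in
   its second one. *)
HB.mixin Record CompleteNormedModule_isHilbert (R : realType) (H : Type)
    of CompleteNormedModule R[i] H := {
  hdot : {dot H for @Num.conj R[i]} ;
  sqr_norm_hdot : forall x : H, `|x| ^+ 2 = hdot x x
}.

#[short(type="hilbertType")]
HB.structure Definition Hilbert (R : realType) :=
  { H of CompleteNormedModule R[i] H & CompleteNormedModule_isHilbert R H }.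

Section Operators.
Context {R : realType} {H : hilbertType R}.
Implicit Types (T : H -> H) (M : set H).

Definition separable (X : topologicalType) :=
  exists2 D : set X, countable D & dense D.

Definition bounded_operator T :=
  exists r : R, forall x, `|T x| <= r%:C%C * `|x|.

(* The value at y is the unique z such that <T x, y> = <x, z> for all x; for a
   bounded linear T it exists by the Riesz representation theorem, so that the
   default value 0 is never used. *)
Definition adjoint T : H -> H := fun y =>
  xget 0 [set z | forall x, hdot (T x) y = hdot x z].

(* On R[i], 0 <= z means that z is real and nonnegative. *)
Definition positive_operator T := forall x, 0 <= hdot (T x) x.

Definition hyponormal T :=
  positive_operator (fun x => adjoint T (T x) - T (adjoint T x)).

Definition closed_subspace M := GRing.submod_closed [in M] /\ closed M.

Definition orbit T (x : H) : set H := range (fun n : nat => iter n T x).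

(* [dense] on the library type [subspace M] would not express density in M:
   there the points outside M are isolated. *)
Definition subspace_hypercyclic T M :=
  exists x : H, M `<=` closure (orbit T x `&` M).

End Operators.

(* Main.v *)
(* Since T is hyponormal, |T* x| <= |T x|, whence
   |T x|^2 = <T* T x, x> <= |T* T x| |x| <= |T^2 x| |x|, and the norms along an
   orbit form a log-convex sequence. Such a sequence is either nonincreasing or
   bounded below by its positive minimum: the orbit is bounded or stays away
   from 0. Neither is compatible with density in a nonzero subspace. *)
Require Import Defs.
From mathcomp Require Import all_boot all_order all_algebra.
From mathcomp Require Import all_classical all_reals all_analysis.
From mathcomp Require Import complex ring lra.
Import Order.TTheory GRing.Theory Num.Theory.
Import numFieldNormedType.Exports.
Local Open Scope classical_set_scope.
Local Open Scope ring_scope.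

Section RealPart.
Context {R : realType} {H : hilbertType R}.
Implicit Types (x y z w : H) (c : R).

(** Norms and inner products on [H] take values in [R[i]]; their real parts live in the totally
    ordered field [R], where [lra] and [nra] apply. *)
Definition nrm x : R := complex.Re `|x|.
Definition rdot x y : R := complex.Re (hdot x y).

Lemma nrmE x : `|x| = (nrm x)%:C%C.
Proof. by rewrite /nrm RRe_real // ger0_real. Qed.

Lemma nrm_ge0 x : 0 <= nrm x.
Proof. by rewrite -ler0c -nrmE. Qed.

Lemma nrm_gt0 x : x != 0 -> 0 < nrm x.
Proof. by rewrite -ltcR -nrmE normr_gt0. Qed.

Lemma nrmD x y : nrm (x + y) <= nrm x + nrm y.
Proof. by rewrite -lecR rmorphD /= -!nrmE ler_normD. Qed.

Lemma nrmZ c x : 0 <= c -> nrm (c%:C%C *: x) = c * nrm x.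
Proof.
move=> c0; apply: complexI.
by rewrite -nrmE normrZ nrmE ger0_norm ?ler0c // rmorphM.
Qed.

Lemma rdotxx x : rdot x x = nrm x ^+ 2.
Proof.
apply: complexI; rewrite rmorphXn /= -nrmE sqr_norm_hdot.
by rewrite RRe_real // ger0_real // dnorm_ge0.
Qed.

Lemma rdotC x y : rdot x y = rdot y x.
Proof. by rewrite /rdot hermC /= expr0 mul1r; case: (hdot y x). Qed.

Lemma rdotDl x y z : rdot (x + y) z = rdot x z + rdot y z.
Proof. by rewrite /rdot linearDl raddfD. Qed.

Lemma rdotZl c x y : rdot (c%:C%C *: x) y = c * rdot x y.
Proof.
rewrite /rdot linearZl_LR /=; case: (hdot x y) => a b /=.
by rewrite mul0r subr0.
Qed.

Lemma rdotDr x y z : rdot z (x + y) = rdot z x + rdot z y.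
Proof. by rewrite rdotC rdotDl !(rdotC _ z). Qed.

Lemma rdotZr c x y : rdot y (c%:C%C *: x) = c * rdot y x.
Proof. by rewrite rdotC rdotZl rdotC. Qed.

Lemma rdotBr x y z : rdot z (x - y) = rdot z x - rdot z y.
Proof. by rewrite /rdot linearBr raddfB. Qed.

Lemma rdotBl x y z : rdot (x - y) z = rdot x z - rdot y z.
Proof. by rewrite rdotC rdotBr !(rdotC z). Qed.

Lemma nrmD2 x y : nrm (x + y) ^+ 2 = nrm x ^+ 2 + 2 * rdot x y + nrm y ^+ 2.
Proof. by rewrite -!rdotxx !rdotDl !rdotDr (rdotC y x); ring. Qed.

(** Cauchy-Schwarz: the squared norm of [|y| x - |x| y] expands to
    [2 |x| |y| (|x| |y| - rdot x y)]. *)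
Lemma rdot_le x y : rdot x y <= nrm x * nrm y.
Proof.
have [->|x0] := eqVneq x 0; first by rewrite /rdot linear0l mulr_ge0 ?nrm_ge0.
have [->|y0] := eqVneq y 0; first by rewrite /rdot linear0r mulr_ge0 ?nrm_ge0.
have := sqr_ge0 (nrm ((nrm y)%:C%C *: x - (nrm x)%:C%C *: y)).
rewrite -rdotxx !rdotBl !rdotBr !rdotZl !rdotZr !rdotxx (rdotC y x).
have p0 : 0 < nrm x * nrm y by rewrite mulr_gt0 ?nrm_gt0.
by move=> h; rewrite -subr_ge0 -(pmulr_rge0 _ p0); nra.
Qed.

(* The minimizer z of |x|^2 - 2 g x exists because the parallelogram law makes
   the minimizing sets a Cauchy filter. *)
Lemma real_riesz (g : H -> R) (C : R) :
  (forall x y, g (x + y) = g x + g y) ->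
  (forall c x, g (c%:C%C *: x) = c * g x) ->
  (forall x, g x <= C * nrm x) ->
  exists z, forall x, g x = rdot x z.
Proof.
move=> gD gZ gC; pose J x := nrm x ^+ 2 - 2 * g x.
have hJ : has_inf (range J).
  split; first by exists (J 0); exists 0.
  (* Completing the square: [J x >= |x|^2 - 2 C |x| >= - C^2]. *)
  exists (- C ^+ 2) => _ [x _ <-]; rewrite /J.
  have := gC x; have := sqr_ge0 (nrm x - C); lra.
pose m := inf (range J).
have mJ x : m <= J x by apply: ge_inf; [exact: hJ.2 | exists x].
pose A (d : R) := [set x | J x < m + d].
(* With [p] the midpoint of [x] and [y], [|x - y|^2 = 2 J x + 2 J y - 4 J p], and [J p >= m]. *)
have A_close d x y : A d x -> A d y -> nrm (x - y) ^+ 2 <= 4 * d.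
  rewrite /A /=; have := mJ ((2^-1 : R)%:C%C *: (x + y)).
  rewrite /J nrmZ ?invr_ge0// gZ gD exprMn (nrmD2 x y) -(rdotxx (x - y)).
  by rewrite rdotBl !rdotBr !rdotxx (rdotC y x); lra.
pose F := filter_from [set d : R | 0 < d] A.
have FF : ProperFilter F.
  apply: filter_from_proper.
    apply: filter_from_filter; first by exists 1; rewrite /= ltr01.
    move=> i j /= i0 j0; exists (Num.min i j); first by rewrite lt_min i0.
    move=> x; rewrite /A /= -ltrBlDl lt_min => /andP[].
    by split; rewrite -ltrBlDl.
  move=> d /= d0; have [_ [x _ <-] hx] := inf_adherent d0 hJ.
  by exists x.
have cvgF : cvg F.
  apply/cauchy_cvgP/cauchyP => e e0.
  have [r r0 ->] : exists2 r : R, 0 < r & e = r%:C%C.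
    by exists (complex.Re e); rewrite -?ltcR RRe_real // gtr0_real.
  (* With this [d], [A_close] gives [|x - y|^2 <= r^2 / 2 < r^2]. *)
  have d0 : 0 < r ^+ 2 / 8 by rewrite divr_gt0 ?exprn_gt0.
  have [_ [x _ <-] hx] := inf_adherent d0 hJ.
  exists x, (r ^+ 2 / 8) => // y /= Ay.
  rewrite -ball_normE /= nrmE ltcR.
  rewrite -(ltr_pXn2r (n := 2)) ?nnegrE ?nrm_ge0 ?(ltW r0)//.
  have := A_close _ x y hx Ay; have : 0 < r ^+ 2 by rewrite exprn_gt0.
  lra.
have [z Fz] : exists z, F --> z by exists (lim F).
have near_z d : 0 < d -> exists2 x, A d x & nrm (z - x) < d.
  move=> d0; have := Fz (ball z d%:C%C) (nbhsx_ballx _ _ _).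
  rewrite ltcR => /(_ d0)[d' /= d'0 sub].
  have mind : 0 < Num.min d d' by rewrite lt_min d0.
  have [_ [x _ <-] hx] := inf_adherent mind hJ.
  have /andP[h1 h2] : (J x < m + d) && (J x < m + d').
    by rewrite -!ltrBlDl -lt_min ltrBlDl.
  by exists x => //; have := sub x h2; rewrite -ball_normE /= nrmE ltcR.
exists z => x.
(* This is [J (z + w) - J z >= 0]. Continuity of [J] is bypassed by comparing [J y] and [J (y + w)]
   for a near-minimizer [y] close to [z]. The total error is [e + 2 |w| e], hence
   [e = d / (1 + 2 |w|)]. *)
have pos w : 0 <= nrm w ^+ 2 + 2 * (rdot w z - g w).
  apply/ler_addgt0Pl => d d0.
  have w0 := nrm_ge0 w.
  have e0 : 0 < d / (1 + 2 * nrm w) by rewrite divr_gt0 // ltr_wpDr // mulr_ge0.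
  have [y Ay zy] := near_z _ e0.
  have := mJ (y + w); move: Ay; rewrite /A /= /J nrmD2 gD.
  have : rdot w (y - z) <= nrm w * (d / (1 + 2 * nrm w)).
    apply: le_trans (rdot_le _ _) _; rewrite ler_wpM2l // ltW //.
    suff -> : nrm (y - z) = nrm (z - y) by [].
    by rewrite /nrm distrC.
  have : d = (d / (1 + 2 * nrm w)) * (1 + 2 * nrm w) by rewrite divfK //; lra.
  rewrite rdotBr (rdotC y w); set e := d / _ in e0 zy *.
  nra.
pose b := rdot x z - g x.
pose N := nrm x ^+ 2.
have quad t : 0 <= t ^+ 2 * N + 2 * t * b.
  have := pos (t%:C%C *: x).
  by rewrite -rdotxx rdotZl rdotZr rdotxx gZ rdotZl /b /N rdotC; lra.
have N0 : 0 < N + 1 by rewrite ltr_wpDl ?sqr_ge0.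
suff b0 : b = 0 by apply/esym/eqP; rewrite -subr_eq0 -/b b0.
(* Dividing by [N + 1] rather than [N] also covers [x = 0]; the quadratic is then a negative
   multiple of a square. *)
have := quad (- b / (N + 1)).
have -> : (- b / (N + 1)) ^+ 2 * N + 2 * (- b / (N + 1)) * b
          = - ((b / (N + 1)) ^+ 2 * (N + 2)) by field; rewrite gt_eqF.
rewrite oppr_ge0 pmulr_lle0; last by lra.
move=> h; apply/eqP.
have : (b / (N + 1)) ^+ 2 == 0 by rewrite eq_le h sqr_ge0.
by rewrite sqrf_eq0 mulf_eq0 invr_eq0 (gt_eqF N0) orbF.
Qed.

(** A complex-linear functional is determined by its real part: the real part of [f (i x)] is minus
    the imaginary part of [f x]. *)
Lemma riesz (f : H -> R[i]) (C : R) :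
  (forall x y, f (x + y) = f x + f y) ->
  (forall a x, f (a *: x) = a * f x) ->
  (forall x, complex.Re (f x) <= C * nrm x) ->
  exists z, forall x, f x = hdot x z.
Proof.
move=> fD fZ fC; have [||//|z zP] := real_riesz (fun x => complex.Re (f x)) C.
- by move=> x y; rewrite fD raddfD.
- by move=> c x; rewrite fZ; case: (f x) => a b /=; rewrite mul0r subr0.
exists z => x; apply/eqP; rewrite eq_complex zP eqxx /=.
have := zP ('i%C *: x); rewrite fZ /rdot linearZl_LR /=.
case: (f x) (hdot x z) => [a b] [a' b'] /=.
by rewrite !mul0r !mul1r !sub0r => /oppr_inj ->.
Qed.

(** Riesz representation of [x -> <T x, y>] rules out the default value of [xget]. *)
Lemma adjointP (T : {linear H -> H}) : bounded_operator T ->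
  forall x y, hdot (T x) y = hdot x (adjoint T y).
Proof.
move=> [r Tr] x y; rewrite /adjoint; case: xgetP => [z _ /(_ x)//|none].
have [||w|z zP] := riesz (fun x => hdot (T x) y) (`|r| * nrm y).
- by move=> u v; rewrite linearD linearDl.
- by move=> a u; rewrite linearZ linearZl_LR.
- apply: le_trans (rdot_le _ _) _; rewrite mulrAC ler_wpM2r ?nrm_ge0//.
  rewrite -lecR rmorphM /= -!nrmE; apply: le_trans (Tr w) _.
  by rewrite ler_wpM2r // lecR ler_norm.
by case: (none z).
Qed.

Lemma hyponormal_sqr_le (T : {linear H -> H}) :
  bounded_operator T -> hyponormal T ->
  forall x, nrm (T x) ^+ 2 <= nrm x * nrm (T (T x)).
Proof.
move=> bT hT; have adj x y : rdot (T x) y = rdot x (adjoint T y).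
  by rewrite /rdot (adjointP _ bT).
(* Hyponormality at [x] reads [|T x|^2 - |T* x|^2 >= 0]; below, this is used at the vector [T x]. *)
have le_adj x : nrm (adjoint T x) <= nrm (T x).
  rewrite -(ler_pXn2r (n := 2)) ?nnegrE ?nrm_ge0 // -!rdotxx.
  have := hT x; rewrite lecE => /andP[_].
  rewrite -/(rdot _ _) rdotBl raddf0 subr_ge0 adj.
  by rewrite (adj x) (rdotC x).
move=> x; rewrite -rdotxx adj; apply: le_trans (rdot_le _ _) _.
by rewrite ler_wpM2l ?nrm_ge0.
Qed.

End RealPart.

(** A strict increase persists forever, so if [n] is the first one, the sequence descends to [a n]
    and then climbs: [a n] is the minimum. *)
Lemma logconvex_le_or_min {R : realDomainType} (a : nat -> R) :
  (forall n, 0 <= a n) -> (forall n, a n = 0 -> a n.+1 = 0) ->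
  (forall n, a n.+1 ^+ 2 <= a n * a n.+2) ->
  (forall n, a n <= a 0%N) \/ exists2 d, 0 < d & forall n, d <= a n.
Proof.
move=> a0 anull acvx.
have [incr|decr] := pselect (exists n, a n < a n.+1); last first.
  left; elim=> // n IH; apply: le_trans IH; rewrite leNgt; apply/negP => lt_n.
  by apply: decr; exists n.
right; case: (ex_minnP incr) => n lt_n min_n.
have lt_above k : a (n + k)%N < a (n + k).+1.
  elim: k => [|k IH]; first by rewrite addn0.
  (* For consecutive terms [p < q] and [s <= q], log-convexity would give [q^2 <= p s <= p q],
     impossible as [0 <= p < q]. *)
  rewrite addnS ltNge; apply/negP => le_k.
  have := acvx (n + k)%N; have := a0 (n + k)%N.
  move: IH le_k; nra.
exists (a n).
  (* If [a n] vanished, so would the next term, against the strict increase at [n]. *)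
  rewrite lt_def a0 andbT; apply/eqP => /[dup] /anull n1 n0.
  by move: lt_n; rewrite n0 n1 ltxx.
have le_above k : a n <= a (n + k)%N.
  elim: k => [|k IH]; first by rewrite addn0.
  by rewrite addnS (le_trans IH) // ltW.
have le_below k : (k <= n)%N -> a n <= a (n - k)%N.
  elim: k => [|k IH] kn; first by rewrite subn0.
  apply: le_trans (IH (ltnW kn)) _; rewrite leNgt; apply/negP.
  rewrite -(subnSK kn) => /min_n; rewrite leqNgt ltn_subrL /=.
  by rewrite (leq_ltn_trans _ kn).
move=> k; have [kn|/ltnW/subnKC <-] := leqP k n; last exact: le_above.
by rewrite -(subKn kn) le_below // leq_subr.
Qed.

Theorem mainTheorem6 (R : realType) (H : hilbertType R) (sepH : separable H)
    (T : {linear H -> H}) (bT : bounded_operator T) (hT : hyponormal T) :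
  forall M : set H, closed_subspace M -> M <> [set 0] ->
    ~ subspace_hypercyclic T M.
Proof.
move=> M [[M0 Mlin] _] Mn0 [x hx].
have {}M0 : M 0 by have := M0; rewrite inE.
have MZ a u : M u -> M (a *: u).
  move=> Mu; have := Mlin a u 0.
  by rewrite !inE addr0; apply.
have [u Mu u0] : exists2 u, M u & u != 0.
  apply: contrapT => none; apply: Mn0; apply/seteqP; split => [u Mu|_ ->//].
  by apply: contrapT => /eqP u0; apply: none; exists u.
have near_orbit v (e : R) : M v -> 0 < e -> exists n, nrm (v - iter n T x) < e.
  move=> Mv e0; have := hx v Mv (ball v e%:C%C) (nbhsx_ballx _ _ _).
  rewrite ltcR => /(_ e0) [_ [[[n _ <-] _]]].
  by rewrite -ball_normE /= nrmE ltcR; exists n.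
have [|n n0|n|bnd|[d d0 dle]] :=
    logconvex_le_or_min (fun n => nrm (iter n T x)).
- by move=> n; exact: nrm_ge0.
- have [z|/(nrm_gt0 _)] := eqVneq (iter n T x) 0; last by rewrite n0 ltxx.
  by rewrite iterS z linear0 /nrm normr0.
- exact: hyponormal_sqr_le.
(* Bounded orbit: [c u] lies in [M] and has norm [|x| + 1], hence is at distance at least 1 from
   every iterate. *)
- pose c := (nrm x + 1) / nrm u.
  have c0 : 0 <= c by rewrite divr_ge0 ?addr_ge0 ?nrm_ge0.
  have [n] := near_orbit _ _ (MZ c%:C%C u Mu) ltr01.
  apply/negP; rewrite -leNgt.
  have nv : nrm (c%:C%C *: u) = nrm x + 1.
    by rewrite nrmZ // divfK // gt_eqF ?nrm_gt0.
  rewrite -(lerD2r (nrm (iter n T x))) (le_trans _ (nrmD _ _)) // subrK nv.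
  by rewrite addrC lerD2r; exact: bnd.
(* Orbit away from 0: no iterate comes within [d] of the point 0 of [M]. *)
- have [n] := near_orbit _ _ M0 d0.
  by rewrite sub0r /nrm normrN -/(nrm _) ltNge dle.
Qed.
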